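(* Let $k,n$ be rational numbers with $n\neq 0$, let $\varepsilon\in\{1,-1\}$, put $p=k^2n$ and $$m=\frac{k}{n}(p-3\varepsilon).$$ Then $$s_0=(p-2\varepsilon)(p-\varepsilon)-1,\quad s_1=kn(p-2\varepsilon),\quad s_2=n(p-\varepsilon)$$ is a solution of the equation $$|F(3,m)|=s_0^3+s_1^3m+s_2^3m^2-3s_0s_1s_2m=1,$$ and so is the conjugate triple $$\overline{s_0}=1,\quad \overline{s_1}=-\varepsilon nk,\quad \overline{s_2}=\varepsilon n .$$
   Context: For a tuple $s=(s_0,s_1,s_2)$ let $X(s)=\begin{pmatrix} s_0&ms_2&ms_1\\ s_1&s_0&ms_2\\ s_2&s_1&s_0\end{pmatrix}$ be the matrix of the form $s_0+s_1\sqrt[3]{m}+s_2\sqrt[3]{m^2}$; $|F(3,m)|=\det X(s)$ is its norm. Tuples $s,\overline{s}$ are called conjugate if $X(s)X(\overline{s})=|F(3,m)|\cdot E$, $E$ the identity matrix. The letter $n$ here is just a parameter. *)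

(* Defs.v *)
From HB Require Import structures.
From mathcomp Require Import all_boot all_order all_algebra.
Set Implicit Arguments.
Unset Strict Implicit.
Unset Printing Implicit Defensive.
Import GRing.Theory.
Local Open Scope ring_scope.

(* The triple (s0, s1, s2) stands for s0 + s1 m^(1/3) + s2 m^(2/3).  No cube
   root of m is needed: everything is expressed through the matrix below. *)
Definition formMx (R : comNzRingType) (m : R) (s : R * R * R) : 'M[R]_3 :=
  let: (s0, s1, s2) := s in
  \matrix_(i < 3, j < 3)
    (nth [::] [:: [:: s0; m * s2; m * s1];
                  [:: s1; s0;     m * s2];
                  [:: s2; s1;     s0    ]] i)`_j.

(* |F(3,m)|: the bars denote a determinant, not an absolute value. *)
Definition formNorm (R : comNzRingType) (m : R) (s : R * R * R) : R :=
  \det (formMx m s).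

Definition conjugate_triples (R : comNzRingType) (m : R) (s t : R * R * R) :
    Prop :=
  formMx m s *m formMx m t = (formNorm m s)%:M.

Definition solves_norm_equation (R : comNzRingType) (m : R) (s : R * R * R) :
    Prop :=
  let: (s0, s1, s2) := s in
  formNorm m s
    = s0 ^+ 3 + s1 ^+ 3 * m + s2 ^+ 3 * m ^+ 2 - 3%:R * s0 * s1 * s2 * m
  /\ s0 ^+ 3 + s1 ^+ 3 * m + s2 ^+ 3 * m ^+ 2 - 3%:R * s0 * s1 * s2 * m = 1.

(* Main.v *)
Require Import Defs.
From HB Require Import structures.
From mathcomp Require Import all_boot all_order all_algebra.
From mathcomp Require Import ring.
Set Implicit Arguments.
Unset Strict Implicit.
Unset Printing Implicit Defensive.
Import GRing.Theory.
Local Open Scope ring_scope.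

(** The matrix X(s) is multiplication by s0 + s1 x + s2 x^2 in the ring R[x]
    modulo x^3 - m, so these matrices multiply like the elements
    ([formMx_mul]) and the norm is multiplicative.

    The conjugate triple 1, - eps n k, eps n is simple enough for its norm to
    be seen to equal 1 directly: m n = k (p - 3 eps) turns the three terms
    after the leading 1 into
    (p - 3 eps) (- eps p^2 + eps p (p - 3 eps) + 3 p), which vanishes because
    eps^2 = 1.  The product of the two elements is 1, which amounts to three
    polynomial identities modulo the same two relations.  Taking determinants
    in X(s) X(sbar) = E then gives norm 1 for s without expanding its cubic
    form, and X(s) X(sbar) = E is conjugacy since that norm is 1. *)

Lemma formNormE (R : comNzRingType) (m s0 s1 s2 : R) :
  formNorm m (s0, s1, s2)
    = s0 ^+ 3 + s1 ^+ 3 * m + s2 ^+ 3 * m ^+ 2 - 3%:R * s0 * s1 * s2 * m.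
Proof.
rewrite /formNorm (expand_det_row _ ord0) !big_ord_recl big_ord0 /cofactor.
rewrite !(expand_det_row _ ord0) !big_ord_recl !big_ord0 /cofactor !det_mx11.
rewrite !mxE /=; ring.
Qed.

(** The triple on the right is the product of the two elements reduced by
    x^3 = m. *)
Lemma formMx_mul (R : comNzRingType) (m s0 s1 s2 t0 t1 t2 : R) :
  formMx m (s0, s1, s2) *m formMx m (t0, t1, t2)
    = formMx m (s0 * t0 + m * (s1 * t2 + s2 * t1),
                s0 * t1 + s1 * t0 + m * (s2 * t2),
                s0 * t2 + s1 * t1 + s2 * t0).
Proof.
apply/matrixP => i j; rewrite !mxE !big_ord_recl big_ord0 !mxE.
by case: i => [[|[|[|//]]] ?]; case: j => [[|[|[|//]]] ?] /=; ring.
Qed.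

Lemma formMx1 (R : comNzRingType) (m : R) : formMx m (1, 0, 0) = 1%:M.
Proof.
apply/matrixP => i j; rewrite !mxE -val_eqE /=.
by case: i => [[|[|[|//]]] ?]; case: j => [[|[|[|//]]] ?] /=; rewrite ?mulr0.
Qed.

Lemma solves_norm_equationP (R : comNzRingType) (m s0 s1 s2 : R) :
  formNorm m (s0, s1, s2) = 1 -> solves_norm_equation m (s0, s1, s2).
Proof. by move=> norm1; split; rewrite -formNormE. Qed.

Theorem mainTheorem4 (k n eps : rat) (hn : n <> 0)
    (heps : eps = 1 \/ eps = -1) :
  let p := k ^+ 2 * n in
  let m := k / n * (p - 3%:R * eps) in
  let s := ((p - 2%:R * eps) * (p - eps) - 1,
            k * n * (p - 2%:R * eps),
            n * (p - eps)) in
  let sbar := (1, - eps * n * k, eps * n) in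
  [/\ solves_norm_equation m s,
      solves_norm_equation m sbar
    & conjugate_triples m s sbar].
Proof.
move=> p m s sbar.
have n_neq0 : n != 0 by apply/eqP.
have norm_sbar : formNorm m sbar = 1.
  by rewrite /sbar formNormE /m /p; case: heps => ->; field.
have mul_s_sbar : formMx m s *m formMx m sbar = 1%:M.
  rewrite formMx_mul -(formMx1 m); congr (formMx m (_, _, _));
    by rewrite /m /p; case: heps => ->; field.
have norm_s : formNorm m s = 1.
  have := congr1 determinant mul_s_sbar.
  by rewrite det_mulmx det1 -/(formNorm m s) -/(formNorm m sbar) norm_sbar mulr1.
split; [exact: solves_norm_equationP..|].
by rewrite /conjugate_triples norm_s.
Qed.
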